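(* Let $A_p\in\mathbb{R}^{n\times n}$, $B_p\in\mathbb{R}^{n\times m}$ with $B_p$ of full column rank, $\Theta_p:=[A_p\ B_p]$, and consider the system $\dot x_p(t)=A_px_p(t)+B_pu(t)$, $x_p(0)=x_{p0}$, $t\ge 0$, with input $u:[0,\infty)\to\mathbb{R}^m$. Let $\mathcal{S}=\{\Theta_1,\dots,\Theta_N\}$, $\Theta_i=[A_i\ B_i]\in\mathbb{R}^{n\times(n+m)}$, be an admissible corner set for $[A_p\ B_p]$. Let $\Phi$, $\varepsilon_i$ and $E$ be the signals defined in the context, and consider the estimation scheme $$\dot{\hat{\bar w}}(t)=-\Gamma E^\top(t)E(t)\hat{\bar w}(t)-\Gamma E^\top(t)\varepsilon_N(t),\qquad \hat w_N(t)=1-\sum_{i=1}^{N-1}\hat w_i(t),$$ where $\Gamma\in\mathbb{R}^{(N-1)\times(N-1)}$ is symmetric positive definite. Suppose that $\Phi$ is bounded and persistently exciting. Then, for any initial condition $\hat{\bar w}(0)\in\mathbb{R}^{N-1}$, the estimated system matrix $\sum_{i=1}^N\hat w_i(t)\Theta_i$ converges to $\Theta_p$ as $t\to\infty$.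
   Context: Admissible corner set: a finite set $\mathcal{S}=\{[A_1\ B_1],\dots,[A_N\ B_N]\}$ with $A_i\in\mathbb{R}^{n\times n}$, $B_i\in\mathbb{R}^{n\times m}$ is admissible for $[A_p\ B_p]$ if (i) $[A_p\ B_p]$ lies in the relative interior of $\operatorname{conv}(\mathcal{S})$, and (ii) every convex combination of $B_1,\dots,B_N$ has full column rank. The input $u$ is such that the differential equations below have solutions on $[0,\infty)$. The estimate is $\hat w(t)=[\hat{\bar w}^\top(t),\hat w_N(t)]^\top\in\mathbb{R}^N$ with $\hat{\bar w}=(\hat w_1,\dots,\hat w_{N-1})$. Signals: fix design constants $\lambda>0$, $\alpha>0$. Let $\phi_1(t)\in\mathbb{R}^n$, $\phi_2(t)\in\mathbb{R}^m$ solve $\dot\phi_1=-\lambda\phi_1+x_p$, $\dot\phi_2=-\lambda\phi_2+u$, $\phi_1(0)=0$, $\phi_2(0)=0$; set $\Phi=[\phi_1^\top,\phi_2^\top]^\top$ and $z(t)=-\lambda\phi_1(t)+x_p(t)$. Define $z_i(t)=\Theta_i\Phi(t)$, $m_s^2(t)=1+\alpha\|\Phi(t)\|^2$ (Euclidean norm), $\varepsilon_i(t)=\dfrac{z(t)-z_i(t)}{m_s^2(t)}$ for $i=1,\dots,N$, and the $n\times(N-1)$ matrix $E(t)=[\varepsilon_1(t)-\varepsilon_N(t)\ \ \cdots\ \ \varepsilon_{N-1}(t)-\varepsilon_N(t)]$. Persistent excitation: $\Phi:[0,\infty)\to\mathbb{R}^k$ is persistently exciting if there exist $\alpha_{\Phi1},\alpha_{\Phi2},T_\Phi>0$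 such that for every $t\ge0$, $\alpha_{\Phi1}I\preceq\int_t^{t+T_\Phi}\Phi(\tau)\Phi^\top(\tau)\,d\tau\preceq\alpha_{\Phi2}I$. *)

(* Defs.v *)
From HB Require Import structures.
From mathcomp Require Import all_boot all_order all_algebra.
From mathcomp Require Import all_classical all_reals all_analysis.
Import Order.TTheory GRing.Theory Num.Theory.
Import numFieldNormedType.Exports.

Set Implicit Arguments.
Unset Strict Implicit.
Unset Printing Implicit Defensive.

Local Open Scope classical_set_scope.
Local Open Scope ring_scope.

Definition full_column_rank (R : realType) (n m : nat) (B : 'M[R]_(n, m)) :
    Prop :=
  \rank B = m.

Definition posdefmx (R : realType) (k : nat) (M : 'M[R]_k) : Prop :=
  M^T = M /\ forall v : 'cV[R]_k, v != 0 -> 0 < (v^T *m M *m v) 0 0.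

Definition possemidefmx (R : realType) (k : nat) (M : 'M[R]_k) : Prop :=
  M^T = M /\ forall v : 'cV[R]_k, 0 <= (v^T *m M *m v) 0 0.

Definition loewner_le (R : realType) (k : nat) (M P : 'M[R]_k) : Prop :=
  possemidefmx (P - M).

Definition eucl_norm (R : realType) (k : nat) (v : 'cV[R]_k) : R :=
  Num.sqrt (\sum_(i < k) v i 0 ^+ 2).

Definition convex_hull (R : realType) (V : lmodType R) (S : set V) : set V :=
  [set x | exists (k : nat) (a : 'I_k -> R) (p : 'I_k -> V),
    [/\ forall i, S (p i), forall i, 0 <= a i, \sum_(i < k) a i = 1
      & x = \sum_(i < k) a i *: p i]].

Definition affine_hull (R : realType) (V : lmodType R) (S : set V) : set V :=
  [set x | exists (k : nat) (a : 'I_k -> R) (p : 'I_k -> V),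
    [/\ forall i, S (p i), \sum_(i < k) a i = 1
      & x = \sum_(i < k) a i *: p i]].

Definition relative_interior (R : realType) (V : normedModType R) (S : set V) :
    set V :=
  [set x | S x /\ exists2 U : set V, nbhs x U & U `&` affine_hull S `<=` S].

(* The corner set is the range of a finite family, whose members need not be
   pairwise distinct. *)
Definition admissible_corner_set (R : realType) (n m N : nat)
    (Ap : 'M[R]_n) (Bp : 'M[R]_(n, m))
    (A : 'I_N -> 'M[R]_n) (B : 'I_N -> 'M[R]_(n, m)) : Prop :=
  relative_interior (convex_hull (range (fun i => row_mx (A i) (B i))))
    (row_mx Ap Bp) /\
  forall a : 'I_N -> R, (forall i, 0 <= a i) -> \sum_(i < N) a i = 1 ->
    full_column_rank (\sum_(i < N) a i *: B i).

(* y solves y' = g, y(0) = y0 on [0, +oo[. Signals are functions on the whole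
   line of which only the values at t >= 0 matter. The equation may fail on a
   countable set of instants, across which y is continuous: this allows inputs
   with jumps, and contains the solutions in the everywhere-differentiable
   sense (for which the exceptional set is empty). *)
Definition ivp_solution (R : realType) (k : nat)
    (y : R -> 'cV[R]_k) (y0 : 'cV[R]_k) (g : R -> 'cV[R]_k) : Prop :=
  [/\ y 0 = y0,
      {within `[0, +oo[, continuous y}
    & exists2 D : set R, countable D &
        forall t : R, 0 < t -> ~ D t -> is_derive t 1 y (g t)].

Definition bounded_signal (R : realType) (k : nat) (f : R -> 'cV[R]_k) : Prop :=
  exists M : R, forall t : R, 0 <= t -> eucl_norm (f t) <= M.

Definition excitation_gramian (R : realType) (k : nat) (f : R -> 'cV[R]_k)
    (t T : R) : 'M[R]_k :=
  \matrix_(i, j)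
    \int[lebesgue_measure]_(tau in `[t, t + T]) ((f tau *m (f tau)^T) i j).

Definition persistently_exciting (R : realType) (k : nat)
    (f : R -> 'cV[R]_k) : Prop :=
  exists a1 a2 T : R, [/\ 0 < a1, 0 < a2, 0 < T &
    forall t : R, 0 <= t ->
      loewner_le a1%:M (excitation_gramian f t T) /\
      loewner_le (excitation_gramian f t T) a2%:M].

Definition filtered_output (R : realType) (n : nat) (lambda : R)
    (xp phi1 : R -> 'cV[R]_n) (t : R) : 'cV[R]_n :=
  - lambda *: phi1 t + xp t.

Definition regressor (R : realType) (n m : nat)
    (phi1 : R -> 'cV[R]_n) (phi2 : R -> 'cV[R]_m) (t : R) : 'cV[R]_(n + m) :=
  col_mx (phi1 t) (phi2 t).

Definition ms_sqr (R : realType) (k : nat) (alpha : R) (Phi : R -> 'cV[R]_k)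
    (t : R) : R :=
  1 + alpha * eucl_norm (Phi t) ^+ 2.

Definition estimation_error (R : realType) (n k : nat) (alpha : R)
    (z : R -> 'cV[R]_n) (Phi : R -> 'cV[R]_k) (Theta : 'M[R]_(n, k))
    (t : R) : 'cV[R]_n :=
  (ms_sqr alpha Phi t)^-1 *: (z t - Theta *m Phi t).

(* Families of N corners are indexed by 'I_(K + 1) with K = N - 1: the first
   N - 1 indices are lshift 1 j for j : 'I_K, the last one is rshift K 0. *)
Definition error_diff_mx (R : realType) (n K : nat)
    (eps : 'I_(K + 1) -> R -> 'cV[R]_n) (t : R) : 'M[R]_(n, K) :=
  \matrix_(i < n, j < K) (eps (lshift 1 j) t - eps (rshift K 0) t) i 0.

Definition full_weights (R : realType) (K : nat) (wbar : R -> 'cV[R]_K)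
    (t : R) : 'cV[R]_(K + 1) :=
  col_mx (wbar t) (const_mx (1 - \sum_(j < K) wbar t j 0)).

(* Main.v *)
(* The residual delta = z - Theta_p Phi satisfies delta' = - lambda delta, so
   it decays exponentially. Theta_p is an affine combination of the corners
   with weights w*; for the error x = wbar - wbar*, the scheme reads
   x' = - Gamma E^T (E x + d) with d = delta / ms^2. Hence
   W = x^T Gamma^-1 x + c exp (- 2 lambda t) satisfies
   W' <= - (|E x|^2 + |d|^2) =: - q. As W >= 0, its variation over windows of
   fixed length tends to 0, and since |x'| = O(sqrt q), so does that of x.
   Finally E x = - (Theta_hat - Theta_p) Phi / ms^2, so the integral of
   |(Theta_hat(t) - Theta_p) Phi(s)|^2 over s in [t, t + T] tends to 0, and
   persistent excitation bounds it below by a |Theta_hat(t) - Theta_p|^2.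
   The corner weights need not converge to w*: only the combination is excited.

   Solutions are differentiable only off a countable set, with derivatives that
   may fail to be integrable (u is arbitrary); all integral estimates are
   therefore monotonicity statements for functions whose derivative has a sign
   off a countable set. *)

Require Import Defs.
From HB Require Import structures.
From mathcomp Require Import all_boot all_order all_algebra.
From mathcomp Require Import all_classical all_reals all_analysis.
From mathcomp Require Import ring lra.
Import Order.TTheory GRing.Theory Num.Theory.
Import numFieldNormedType.Exports.

Set Implicit Arguments.
Unset Strict Implicit.
Unset Printing Implicit Defensive.

Local Open Scope classical_set_scope.
Local Open Scope ring_scope.

(** * Monotonicity from the sign of a derivative off a countable set *)

Lemma is_derive_lt0_right (R : realType) (f : R -> R) (x df : R) :
  is_derive x 1 f df -> df < 0 ->
  exists2 e, 0 < e & forall y, x < y < x + e -> f y < f x.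
Proof.
move=> [fx fxE] df0.
have : h^-1 *: (f (h *: 1 + x) - f x) @[h --> 0^'] --> df.
  by move: fx; rewrite /derivable -fxE; exact.
move=> /cvgr_lt/(_ _ df0) /nbhs_ballP[e /= e0 He].
exists e => // y /andP[xy yxe]; have yx0 : 0 < y - x by rewrite subr_gt0.
have := He (y - x); rewrite /ball/= sub0r normrN gtr0_norm//.
rewrite ltrBlDl gt_eqF// => /(_ yxe isT).
by rewrite scaler1 subrK /GRing.scale/= pmulr_rlt0 ?invr_gt0// subr_lt0.
Qed.

(** Countable sets are Lebesgue null, whereas a nonempty open interval has positive measure. *)
Lemma itvoo_nsubset_countable (R : realType) (a b : R) (D : set R) :
  a < b -> countable D -> exists2 c, a < c < b & ~ D c.
Proof.
move=> ab cD; apply: contrapT => /forall2NP nD.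
have sub : `]a, b[ `<=` D.
  by move=> x /=; rewrite in_itv/= => axb; have [|/contrapT] := nD x.
have := countable_lebesgue_measure0 (sub_countable (subset_card_le sub) cD).
rewrite lebesgue_measure_itv/= lte_fin ab => /eqP.
by rewrite -EFinB eqe subr_eq0 gt_eqF.
Qed.

(* A value [c] in [(f a, f b)] outside the countable set [f @` D] is last
   attained at some [s] where [f] is differentiable and leaves [c] upwards. *)
Lemma derive_lt0_nonincreasing (R : realType) (f g : R -> R) (D : set R)
    (a b : R) : a <= b ->
  (forall x, a <= x <= b -> {for x, continuous f}) -> countable D ->
  (forall x, a < x < b -> ~ D x -> is_derive x 1 f (g x)) ->
  (forall x, a < x < b -> g x < 0) -> f b <= f a.
Proof.
move=> ab cf cD fg g0; rewrite leNgt; apply/negP => fab.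
have cfD : countable (f @` D) by exact: sub_countable (card_image_le _ _) cD.
have [c /andP[fac cfb] nDc] := itvoo_nsubset_countable fab cfD.
pose S := [set x | a <= x <= b /\ f x <= c].
have Sa : S a by split; [rewrite lexx ab|exact: ltW].
have ubS : ubound S b by move=> x [/andP[]].
have supS : has_sup S by split; [exists a|exists b].
set s := sup S.
have as_ : a <= s by apply: ub_le_sup Sa; exists b.
have sb : s <= b by apply: ge_sup; [exists a|].
have cfs : {for s, continuous f} by apply: cf; rewrite as_ sb.
have fsc : f s <= c.
  rewrite leNgt; apply/negP => csf.
  have /nbhs_ballP[e /= e0 He] : \forall x \near s, c < f x.
    exact: (cvgr_gt _ cfs).
  have [x [Sx fxc] sex] := sup_adherent e0 supS.
  have xs : x <= s by apply: ub_le_sup (conj Sx fxc); exists b.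
  have : ball s e x.
    by rewrite /ball/= ger0_norm ?subr_ge0//; move: sex; rewrite -/s; lra.
  by move/He => /=; rewrite ltNge fxc.
have slb : s < b.
  rewrite lt_neqAle sb andbT; apply/eqP => sE.
  by move: fsc; rewrite sE leNgt cfb.
(* Otherwise the point [y], which lies beyond [s] but below both [s + e] and [b], would belong to
   [S], against [s = sup S]. *)
have right e : 0 < e -> ~ (forall y, s < y < s + e -> f y <= c).
  move=> e0 He; pose y := s + Num.min e (b - s) / 2.
  have m0 : 0 < Num.min e (b - s) by rewrite lt_min e0 subr_gt0.
  have me : Num.min e (b - s) <= e by rewrite ge_min lexx.
  have mb : Num.min e (b - s) <= b - s by rewrite ge_min lexx orbT.
  have sy : s < y by rewrite /y; lra.
  have : S y.
    split; first by apply/andP; split; rewrite /y; lra.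
    by apply: He; rewrite sy /y /=; lra.
  by move=> Sy; have := ub_le_sup (ex_intro _ b ubS) Sy; rewrite leNgt sy.
have fsE : f s = c.
  apply/eqP; rewrite eq_le fsc leNgt; apply/negP => fsltc.
  have /nbhs_ballP[e /= e0 He] : \forall x \near s, f x < c.
    exact: (cvgr_lt _ cfs).
  apply: (right e e0) => y /andP[sy yse]; apply/ltW/He.
  by rewrite /ball/= distrC gtr0_norm ?subr_gt0// ltrBlDl.
have asl : a < s.
  rewrite lt_neqAle as_ andbT; apply/eqP => sE.
  by move: fac; rewrite sE fsE ltxx.
have nDs : ~ D s by move=> Ds; apply: nDc; exists s.
have asb : a < s < b by rewrite asl.
have [e e0 He] := is_derive_lt0_right (fg _ asb nDs) (g0 _ asb).
by apply: (right e e0) => y /He /ltW; rewrite fsE.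
Qed.

(** Subtracting [k t] with [k > 0] makes the derivative strictly negative, at the cost of an error
    [k (b - a)] that is at most an arbitrary [e]. *)
Lemma derive_le0_nonincreasing (R : realType) (f g : R -> R) (D : set R)
    (a b : R) : a <= b ->
  (forall x, a <= x <= b -> {for x, continuous f}) -> countable D ->
  (forall x, a < x < b -> ~ D x -> is_derive x 1 f (g x)) ->
  (forall x, a < x < b -> g x <= 0) -> f b <= f a.
Proof.
move=> ab cf cD fg g0; apply/ler_addgt0Pr => e e0.
(* The [+ 1] keeps the denominator positive when [a = b]. *)
pose k := e / (b - a + 1); have k0 : 0 < k by rewrite divr_gt0//; lra.
have : (f - k \*: id) b <= (f - k \*: id) a.
  apply: (@derive_lt0_nonincreasing _ _ (fun x => g x - k *: 1) D) => // x axb.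
  - by apply: continuousB; [exact: cf|apply: continuousZr; exact: cvg_id].
  - move=> /(fg _ axb) dfx; exact: is_deriveB.
  - by have := g0 _ axb; rewrite scaler1; lra.
rewrite !fctE /=.
rewrite /GRing.scale/=.
have : k * (b - a + 1) = e by rewrite mulfVK//; lra.
lra.
Qed.

(** * Calculus of functions differentiable off a countable set *)

Lemma countable_setU (T : Type) (A B : set T) :
  countable A -> countable B -> countable (A `|` B).
Proof.
move=> cA cB; rewrite -bigcup2E; apply: bigcup_countable => // -[|[|i]] _ //=.
Qed.

Lemma within_continuous_gt0 (R : realType) (U : topologicalType) (f : R -> U)
    (t : R) :
  {within `[0, +oo[, continuous f} -> 0 < t -> {for t, continuous f}.
Proof.
move=> cf t0; have : {within `]0, +oo[, continuous f}.
  by apply: continuous_subspaceW cf => x /=; rewrite !in_itv/= !andbT => /ltW.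
rewrite continuous_open_subspace; last exact: interval_open.
by move=> /(_ t); rewrite inE/= in_itv/= andbT => /(_ t0).
Qed.

(** Times are positive because signals are arbitrary at negative times, so nothing two-sided is
    known at 0. Continuity is asked at every positive time: it excludes jumps at the exceptional
    instants. *)
Definition has_cocountable_derivative (R : realType) (f g : R -> R) : Prop :=
  (forall t, 0 < t -> {for t, continuous f}) /\
  exists2 D : set R, countable D &
    forall t, 0 < t -> ~ D t -> is_derive t 1 f (g t).

Section cocountable_derivative.
Variable R : realType.
Implicit Types (f g h : R -> R) (a b c : R).
Local Notation deriv := (@has_cocountable_derivative R).

Lemma cocountable_derivative_eq f g h :
  (forall t, 0 < t -> g t = h t) -> deriv f g -> deriv f h.
Proof.
move=> gh [cf [D cD fg]]; split=> //; exists D => // t t0 nDt.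
by rewrite -gh//; exact: fg.
Qed.

Lemma is_derive_cocountable_derivative f g :
  (forall t : R, is_derive t 1 f (g t)) -> deriv f g.
Proof.
move=> fg; split; last by exists set0.
move=> t _; apply: differentiable_continuous; apply/derivable1_diffP.
by have [] := fg t.
Qed.

Lemma cocountable_derivative_cst c : deriv (fun=> c) (fun=> 0).
Proof.
by apply: is_derive_cocountable_derivative => t; exact: is_derive_cst.
Qed.

Lemma cocountable_derivative_mulrl c : deriv (fun t => c * t) (fun=> c).
Proof.
apply: is_derive_cocountable_derivative => t.
by have := is_deriveZ c (is_derive_id t (1 : R)); rewrite scaler1.
Qed.

Lemma cocountable_derivative_expR c :
  deriv (fun t => expR (c * t)) (fun t => c * expR (c * t)).
Proof.
apply: is_derive_cocountable_derivative => t; rewrite mulrC.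
apply: (@is_derive1_comp _ expR (fun t => c * t)).
by have := is_deriveZ c (is_derive_id t (1 : R)); rewrite scaler1.
Qed.

Lemma cocountable_derivativeD f1 g1 f2 g2 : deriv f1 g1 -> deriv f2 g2 ->
  deriv (fun t => f1 t + f2 t) (fun t => g1 t + g2 t).
Proof.
move=> [cf1 [D1 cD1 d1]] [cf2 [D2 cD2 d2]]; split=> [t t0|].
  by apply: continuousD; [exact: cf1|exact: cf2].
exists (D1 `|` D2); first exact: countable_setU.
by move=> t t0 /not_orP[n1 n2]; apply: is_deriveD; [exact: d1|exact: d2].
Qed.

Lemma cocountable_derivativeM f1 g1 f2 g2 : deriv f1 g1 -> deriv f2 g2 ->
  deriv (fun t => f1 t * f2 t) (fun t => f1 t * g2 t + f2 t * g1 t).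
Proof.
move=> [cf1 [D1 cD1 d1]] [cf2 [D2 cD2 d2]]; split=> [t t0|].
  by apply: continuousM; [exact: cf1|exact: cf2].
exists (D1 `|` D2); first exact: countable_setU.
by move=> t t0 /not_orP[n1 n2]; apply: is_deriveM; [exact: d1|exact: d2].
Qed.

Lemma cocountable_derivativeZ c f g :
  deriv f g -> deriv (fun t => c * f t) (fun t => c * g t).
Proof.
move=> fg; apply: cocountable_derivative_eq
  (cocountable_derivativeM (cocountable_derivative_cst c) fg) => t _.
by rewrite mulr0 addr0.
Qed.

Lemma cocountable_derivative_sum (I : Type) (r : seq I) (F G : I -> R -> R) :
  (forall i, deriv (F i) (G i)) ->
  deriv (fun t => \sum_(i <- r) F i t) (fun t => \sum_(i <- r) G i t).
Proof.
move=> FG; elim: r => [|i r IHr].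
  under eq_fun do rewrite big_nil.
  under [X in deriv _ X]eq_fun do rewrite big_nil.
  exact: cocountable_derivative_cst.
under eq_fun do rewrite big_cons.
under [X in deriv _ X]eq_fun do rewrite big_cons.
exact: cocountable_derivativeD.
Qed.

(** This replaces integrating [g1 <= g2], with no integrability required: [f1 - f2] has a
    nonpositive derivative off a countable set. *)
Lemma cocountable_derivative_le f1 g1 f2 g2 a b :
  deriv f1 g1 -> deriv f2 g2 -> 0 < a -> a <= b ->
  (forall t, a < t < b -> g1 t <= g2 t) -> f1 b - f1 a <= f2 b - f2 a.
Proof.
move=> d1 d2 a0 ab g12.
have [cf [D cD fg]] :=
  cocountable_derivativeD d1 (cocountable_derivativeZ (-1) d2).
suff : f1 b + -1 * f2 b <= f1 a + -1 * f2 a by lra.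
apply: (@derive_le0_nonincreasing _ (fun t => f1 t + -1 * f2 t)
  (fun t => g1 t + -1 * g2 t) D) => // [t /andP[at_ _]|t /andP[at_ _]|t /g12].
- by apply: cf; exact: lt_le_trans at_.
- by apply: fg; exact: lt_trans at_.
- lra.
Qed.

(** Coordinate maps are linear and continuous, hence commute with the limit of difference quotients.
    The differential equations are used only in this scalar form. *)
Lemma ivp_solution_coord (k : nat) (y g : R -> 'cV[R]_k) y0 (i : 'I_k) :
  ivp_solution y y0 g -> deriv (fun t => y t i 0) (fun t => g t i 0).
Proof.
move=> [_ cy [D cD dy]]; split=> [t t0|].
  have cyt := within_continuous_gt0 cy t0.
  exact: (@continuous_comp _ _ _ y (fun M : 'cV[R]_k => M i 0) t cyt
    (@coord_continuous R k 1 i 0 (y t))).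
exists D => // t t0 nDt; have [dyt dytE] := dy t t0 nDt.
have cvt : h^-1 *: (y (h *: 1 + t) - y t) @[h --> 0^'] --> g t.
  by move: dyt; rewrite /derivable -dytE; exact.
have /= cvti :
    (h^-1 *: (y (h *: 1 + t) i 0 - y t i 0)) @[h --> 0^'] --> g t i 0.
  have := cvg_comp _ _ cvt (@coord_continuous R k 1 i 0 (g t)).
  apply: cvg_trans; apply: near_eq_cvg; near=> h.
  by rewrite /= !mxE.
apply: DeriveDef; first by apply/cvg_ex; exists (g t i 0).
exact: cvg_lim.
Unshelve. all: by end_near. Qed.

End cocountable_derivative.

(** * Consequences of a Lyapunov inequality *)

Section lyapunov_consequences.
Variable R : realType.
Variables (W W' q : R -> R).
Hypothesis dW : has_cocountable_derivative W W'.
Hypothesis W_ge0 : forall t, 0 < t -> 0 <= W t.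
Hypothesis q_ge0 : forall t, 0 < t -> 0 <= q t.
Hypothesis W'_le : forall t, 0 < t -> W' t <= - q t.

Lemma lyapunov_nonincreasing a b : 0 < a -> a <= b -> W b <= W a.
Proof.
move=> a0 ab; rewrite -subr_le0 -(subrr (0 : R)).
have d0 := cocountable_derivative_cst (0 : R).
apply: (cocountable_derivative_le dW d0) => // t /andP[at_ _].
have t0 : 0 < t by exact: lt_trans at_.
by rewrite (le_trans (W'_le t0))// oppr_le0 q_ge0.
Qed.

(** [W] is nonincreasing and bounded below: once it is within [e] of its infimum, it cannot drop by
    more than [e]. *)
Lemma lyapunov_tail e : 0 < e ->
  \forall t \near +oo, forall s, t <= s -> W t - W s <= e.
Proof.
move=> e0; pose S := [set W t | t in [set t | 0 < t]].
have infS : has_inf S.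
  split; first by exists (W 1), 1 => /=.
  by exists 0 => _ [t t0 <-]; exact: W_ge0.
have [_ [t0 /= t0_gt0 <-] Wt0] := inf_adherent e0 infS.
exists t0; split; [exact: num_real|move=> t /ltW t0t s ts].
have : inf S <= W s.
  apply: ge_inf; first by case: infS.
  by exists s => //=; apply: lt_le_trans ts; exact: lt_le_trans t0t.
have := lyapunov_nonincreasing t0_gt0 t0t; lra.
Qed.

(* [C * (k + q / k)] is what AM-GM makes of [2 * C * sqrt q]: a signal whose
   derivative is square integrable varies arbitrarily little over windows of
   fixed length. *)
Lemma lyapunov_slowly_varying (f f' : R -> R) C e T :
  has_cocountable_derivative f f' -> 0 <= C ->
  (forall k t, 0 < k -> 0 < t -> `|f' t| <= C * (k + q t / k)) ->
  0 < e -> 0 < T ->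
  \forall t \near +oo, forall s, t <= s <= t + T -> `|f s - f t| <= e.
Proof.
move=> df C0 f'C e0 T0.
(* [k] and [r] make each of the two terms of the bound [bnd] at most [e / 2]; [C + 1] instead of [C]
   avoids dividing by 0. *)
pose k := e / (2 * (C + 1) * T).
have C1 : 0 < C + 1 by lra.
have k0 : 0 < k by rewrite !(divr_gt0, mulr_gt0, ltr0n).
have kE : (C + 1) * k * T = e / 2 by rewrite /k; field; rewrite !gt_eqF.
pose r := e * k / (2 * (C + 1)).
have r0 : 0 < r by rewrite !(divr_gt0, mulr_gt0, ltr0n).
have rE : (C + 1) / k * r = e / 2 by rewrite /r; field; rewrite !gt_eqF.
near=> t; move=> s /andP[ts stT].
have tp : 0 < t by near: t; exact: nbhs_pinfty_gt.
have Wts : W t - W s <= r by move: s ts {stT}; near: t; exact: lyapunov_tail.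
have Ck : 0 <= C / k by rewrite divr_ge0// ltW.
have bnd : C * k * (s - t) + C / k * (W t - W s) <= e.
  have : C * k * (s - t) <= e / 2.
    have := ler_wpM2l (mulr_ge0 C0 (ltW k0)) (_ : s - t <= T).
    rewrite lerBlDl => /(_ stT).
    by have := mulr_ge0 (ltW k0) (ltW T0); lra.
  have : C / k * (W t - W s) <= e / 2.
    have := ler_wpM2l Ck Wts.
    by have := divr_ge0 (ltW r0) (ltW k0); lra.
  lra.
(* The comparison function [C k t - (C / k) W t] has a derivative dominating both [f'] and
   [- f']. *)
have dB := cocountable_derivativeD (cocountable_derivative_mulrl (C * k))
  (cocountable_derivativeZ (- (C / k)) dW).
have f'B x : t < x < s -> `|f' x| <= C * k + - (C / k) * W' x.
  move=> /andP[tx _]; have x0 := lt_trans tp tx.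
  rewrite (le_trans (f'C _ _ k0 x0))// mulrDr lerD2l mulNr -mulrN.
  rewrite mulrA mulrAC ler_wpM2l// lerNr; exact: W'_le.
have f'_ge x : t < x < s -> -1 * f' x <= C * k + - (C / k) * W' x.
  by move=> /f'B; rewrite ler_norml => /andP[]; lra.
have f'_le x : t < x < s -> f' x <= C * k + - (C / k) * W' x.
  by move=> /f'B; rewrite ler_norml => /andP[].
have := cocountable_derivative_le
  (cocountable_derivativeZ (-1) df) dB tp ts f'_ge.
have := cocountable_derivative_le df dB tp ts f'_le.
by rewrite ler_norml; lra.
Unshelve. all: by end_near. Qed.

End lyapunov_consequences.

(** * Entrywise limits, integrals and persistent excitation *)

Lemma cvg_mx (R : realType) (T : Type) (F : set_system T) (m n : nat)
    (f : T -> 'M[R]_(m, n)) (M : 'M[R]_(m, n)) : Filter F ->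
  (forall i j, (fun t => f t i j) @ F --> M i j) -> f @ F --> M.
Proof.
move=> FF fM A [P PM PA].
have : \forall t \near F, forall i j, P i j (f t i j).
  apply: filter_forall => i; apply: filter_forall => j.
  exact: fM (PM i j).
by apply: filterS => t Pt; exact: PA.
Qed.

Section integral.
Variables (R : realType) (f : R -> R).
Hypothesis cf : {within `[0, +oo[, continuous f}.
Local Notation mu := (@lebesgue_measure R).

Lemma integrable_itv0 b : mu.-integrable `[0, b] (EFin \o f).
Proof.
apply: continuous_compact_integrable; first exact: segment_compact.
apply: continuous_subspaceW cf => x /=.
by rewrite !in_itv/= andbT => /andP[].
Qed.

Lemma cocountable_derivative_integral :
  has_cocountable_derivative (fun t => \int[mu]_(s in `[0, t]) f s) f.
Proof.
have dF (t : R) : 0 < t ->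
    is_derive t 1 (fun t => \int[mu]_(s in `[0, t]) f s) (f t).
  move=> t0; have cft := within_continuous_gt0 cf t0.
  have tt1 : t < t + 1 by rewrite ltrDl.
  have [dt dtE] := continuous_FTC1_closed tt1 (integrable_itv0 _) t0 cft.
  by split; [exact: dt|rewrite -derive1E; exact: dtE].
split; last by exists set0 => // t t0 _; exact: dF.
move=> t t0; apply: differentiable_continuous; apply/derivable1_diffP.
by have [] := dF t t0.
Qed.

Lemma Rintegral_itv_sub a b : 0 < a -> a <= b ->
  \int[mu]_(s in `[a, b]) f s =
  \int[mu]_(s in `[0, b]) f s - \int[mu]_(s in `[0, a]) f s.
Proof.
move=> a0 ab; rewrite Rintegral_itvB ?bnd_simp ?(ltW a0)//; last first.
  exact: integrable_itv0.
rewrite Rintegral_itv_obnd_cbnd//.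
apply: integrableS (integrable_itv0 b) => //=.
move=> x /=; rewrite !in_itv/= => /andP[/ltW ax ->].
by rewrite (le_trans (ltW a0)).
Qed.

End integral.

Lemma within_continuous_coord (R : realType) (k : nat) (A : set R)
    (y : R -> 'cV[R]_k) (i : 'I_k) :
  {within A, continuous y} -> {within A, continuous (fun t => y t i 0)}.
Proof.
move=> cy t.
apply: (@continuous_comp (subspace A) _ _ y (fun M : 'cV[R]_k => M i 0)).
  exact: cy.
exact: coord_continuous.
Qed.

Lemma mx_bilinearE (R : realType) (k : nat) (M : 'M[R]_k) (u v : 'cV[R]_k) :
  (u^T *m M *m v) 0 0 = \sum_i \sum_j u i 0 * v j 0 * M i j.
Proof.
rewrite mxE exchange_big /=; apply: eq_bigr => j _.
rewrite !mxE mulr_suml; apply: eq_bigr => i _; rewrite !mxE.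
by rewrite mulrAC.
Qed.

(** For a fixed [v], the Gramian form is the integral of the square of [v . Phi], which is at most
    [h]. The upper bound enters through a primitive [H], since [h] itself may fail to be
    integrable. *)
Lemma excitation_lower_bound (R : realType) (k : nat) (Phi : R -> 'cV[R]_k)
    (a T t : R) (v : 'cV[R]_k) (H h : R -> R) :
  (forall i, {within `[0, +oo[, continuous (fun t => Phi t i 0)}) ->
  0 < t -> 0 < T ->
  loewner_le a%:M (excitation_gramian Phi t T) ->
  has_cocountable_derivative H h ->
  (forall s, t < s < t + T -> (\sum_i v i 0 * Phi s i 0) ^+ 2 <= h s) ->
  a * \sum_i v i 0 ^+ 2 <= H (t + T) - H t.
Proof.
move=> cPhi t0 T0 [_ /(_ v)] aG dH hH.
have cPP i j : {within `[0, +oo[, continuous (fun s => Phi s i 0 * Phi s j 0)}.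
  by move=> s; apply: continuousM; exact: cPhi.
(* With primitives taken from 0, the quadratic form becomes an increment of a function of time, to
   be compared with that of [H]. *)
pose F i j s := \int[lebesgue_measure]_(x in `[0, s]) (Phi x i 0 * Phi x j 0).
have GE i j : excitation_gramian Phi t T i j = F i j (t + T) - F i j t.
  rewrite /F -Rintegral_itv_sub// ?lerDl ?(ltW T0)// mxE.
  by apply: eq_Rintegral => x _; rewrite mxE big_ord1 !mxE.
have {aG} : a * \sum_i v i 0 ^+ 2 <=
    \sum_i \sum_j v i 0 * v j 0 * F i j (t + T) -
    \sum_i \sum_j v i 0 * v j 0 * F i j t.
  rewrite -subr_ge0; move: aG; congr (_ <= _).
  rewrite mulmxBr mulmxBl mxE [X in _ + X]mxE mx_bilinearE; congr (_ - _).
    rewrite -sumrB; apply: eq_bigr => i _; rewrite -sumrB.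
    by apply: eq_bigr => j _; rewrite GE mulrBr.
  rewrite mul_mx_scalar -scalemxAl !mxE; congr (_ * _).
  by apply: eq_bigr => i _; rewrite mxE.
move=> /le_trans; apply.
apply: (@cocountable_derivative_le _
  (fun s => \sum_i \sum_j v i 0 * v j 0 * F i j s)
  (fun s => \sum_i \sum_j v i 0 * v j 0 * (Phi s i 0 * Phi s j 0)) _ h) => //.
- do 2 apply: cocountable_derivative_sum => ?.
  exact/cocountable_derivativeZ/cocountable_derivative_integral.
- by rewrite lerDl ltW.
- move=> s /hH; congr (_ <= _); rewrite expr2 mulr_suml; apply: eq_bigr => i _.
  by rewrite mulr_sumr; apply: eq_bigr => j _; ring.
Qed.

(** The vector is frozen at [t]: on the window, [v t . Phi s] differs from [v s . Phi s] by a small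
    term, as [v] varies slowly. The square of [v s . Phi s] is at most [- c W'], whose contribution
    is the vanishing decrease of [W]. Excitation then bounds [v t] itself. *)
Lemma excited_vanish (R : realType) (k : nat) (W W' q : R -> R)
    (Phi v v' : R -> 'cV[R]_k) (C c M a T : R) :
  has_cocountable_derivative W W' ->
  (forall t, 0 < t -> 0 <= W t) ->
  (forall t, 0 < t -> 0 <= q t) ->
  (forall t, 0 < t -> W' t <= - q t) ->
  (forall i, {within `[0, +oo[, continuous (fun t => Phi t i 0)}) ->
  (forall t i, 0 < t -> `|Phi t i 0| <= M) ->
  0 < a -> 0 < T ->
  (forall t, 0 < t -> loewner_le a%:M (excitation_gramian Phi t T)) ->
  0 <= C -> 0 <= c ->
  (forall j,
     has_cocountable_derivative (fun t => v t j 0) (fun t => v' t j 0)) ->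
  (forall j e t, 0 < e -> 0 < t -> `|v' t j 0| <= C * (e + q t / e)) ->
  (forall t, 0 < t -> (\sum_j v t j 0 * Phi t j 0) ^+ 2 <= c * q t) ->
  forall j, v t j 0 @[t --> +oo] --> 0.
Proof.
move=> dW W0 q0 W'q cPhi PhiM a0 T0 aG C0 c0 dv v'C vPhi j.
apply/cvgr0Pnorm_le => /= e e0.
have e20 : 0 < a * e ^+ 2 by rewrite mulr_gt0// exprn_gt0.
(* The target [a e^2] is split into halves [s1]: [r] bounds the variation of [v] and [p] the
   decrease of [W] over a window, so that [b r^2 <= s1] and [2 c p <= s1]. The minimum with 1 gives
   [r^2 <= r]. *)
pose b := 2 * T * (k%:R * M) ^+ 2.
have b0 : 0 <= b by rewrite mulr_ge0 ?sqr_ge0 ?mulr_ge0 ?ltW.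
have b10 : 0 < b + 1 by lra.
have c10 : 0 < 2 * c + 1 by lra.
pose s1 := a * e ^+ 2 / 2.
have s10 : 0 < s1 by rewrite divr_gt0.
pose r := Num.min 1 (s1 / (b + 1)).
have r0 : 0 < r by rewrite lt_min ltr01 divr_gt0.
have br : b * r ^+ 2 <= s1.
  have r1 : r <= 1 by rewrite ge_min lexx.
  have rs : r * (b + 1) <= s1 by rewrite -ler_pdivlMr// ge_min lexx orbT.
  have : b * r ^+ 2 <= b * r by rewrite ler_wpM2l// expr2 ger_pMr.
  by nra.
pose p := s1 / (2 * c + 1).
have p0 : 0 < p by rewrite divr_gt0.
have cp : 2 * c * p <= s1.
  have : p * (2 * c + 1) = s1 by rewrite mulfVK// gt_eqF.
  by nra.
near=> t.
have t0 : 0 < t by near: t; exact: nbhs_pinfty_gt.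
have Wt : W t - W (t + T) <= p.
  have : forall s, t <= s -> W t - W s <= p.
    by near: t; exact: (lyapunov_tail dW W0 q0 W'q).
  by apply; rewrite lerDl ltW.
have vt : forall i s, t <= s <= t + T -> `|v s i 0 - v t i 0| <= r.
  near: t; apply: filter_forall => i.
  exact: (lyapunov_slowly_varying dW W0 q0 W'q (dv i) C0 (v'C i) r0 T0).
(* This is [(x - y)^2 <= 2 x^2 + 2 y^2], with [x = v s . Phi s] and [y] the effect of the variation
   of [v]. *)
have key s : t < s < t + T -> (\sum_i v t i 0 * Phi s i 0) ^+ 2 <=
    - (2 * c) * W' s + 2 * (k%:R * M * r) ^+ 2.
  move=> /andP[ts sT]; have s0 : 0 < s by exact: lt_trans ts.
  have tsT : t <= s <= t + T by rewrite (ltW ts) (ltW sT).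
  have -> : \sum_i v t i 0 * Phi s i 0 =
      \sum_i v s i 0 * Phi s i 0 - \sum_i (v s i 0 - v t i 0) * Phi s i 0.
    by rewrite -sumrB; apply: eq_bigr => i _; ring.
  set x := \sum_i v s i 0 * _; set y := \sum_i (_ - _) * _.
  have xc : x ^+ 2 <= c * q s by exact: vPhi.
  have yb : `|y| <= k%:R * M * r.
    rewrite (le_trans (ler_norm_sum _ _ _))//.
    apply: (@le_trans _ _ (\sum_(i < k) M * r)).
      apply: ler_sum => i _; rewrite normrM mulrC ler_pM//; first exact: PhiM.
      exact: vt.
    by rewrite sumr_const card_ord -[leLHS]mulr_natl mulrA.
  have y2 : y ^+ 2 <= (k%:R * M * r) ^+ 2.
    by rewrite -(real_normK (num_real y)) ler_sqr// nnegrE// (le_trans _ yb).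
  have cW : c * q s <= - c * W' s.
    by rewrite mulNr -mulrN ler_wpM2l// lerNr W'q.
  have : 0 <= (x + y) ^+ 2 by exact: sqr_ge0.
  nra.
have dH := cocountable_derivativeD (cocountable_derivativeZ (- (2 * c)) dW)
  (cocountable_derivative_mulrl (2 * (k%:R * M * r) ^+ 2)).
have := excitation_lower_bound cPhi t0 T0 (aG t t0) dH key.
have vj : v t j 0 ^+ 2 <= \sum_i v t i 0 ^+ 2.
  by rewrite (bigD1 j)//= lerDl sumr_ge0// => i _; exact: sqr_ge0.
have cWp : 2 * c * (W t - W (t + T)) <= 2 * c * p.
  by rewrite ler_wpM2l// mulr_ge0.
move=> av.
have : a * v t j 0 ^+ 2 <= a * e ^+ 2.
  apply: (le_trans (ler_wpM2l (ltW a0) vj)).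
  have bE : b * r ^+ 2 = 2 * (k%:R * M * r) ^+ 2 * T by rewrite /b; ring.
  rewrite (splitr (a * e ^+ 2)) -/s1.
  lra.
rewrite ler_pM2l// => ve.
rewrite -(ler_pXn2r (isT : (0 < 2)%N)) ?nnegrE ?normr_ge0 ?(ltW e0)//.
by rewrite real_normK ?num_real.
Unshelve. all: by end_near. Qed.

(** * Exponential decay and the Lyapunov function of the gradient scheme *)

Lemma posdefmx_unit (R : realType) (k : nat) (G : 'M[R]_k) :
  posdefmx G -> G \in unitmx.
Proof.
move=> [_ Gpos]; rewrite -row_free_unit -kermx_eq0.
apply/rowV0P => v /sub_kermxP vG.
apply/eqP; rewrite -trmx_eq0; apply: contraT => /Gpos.
by rewrite trmxK vG mul0mx mxE ltxx.
Qed.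

(** [f t * expR (l t)] has zero derivative, so comparison with a constant in both directions makes
    it constant. The reference time is 1 because only positive times are available. *)
Lemma decay_ode (R : realType) (f : R -> R) (l : R) :
  has_cocountable_derivative f (fun t => - l * f t) ->
  exists c, forall t, 0 < t -> f t = c * expR (- l * t).
Proof.
move=> df; exists (f 1 * expR l) => t t0.
have dg : has_cocountable_derivative (fun s => f s * expR (l * s)) (fun=> 0).
  apply: cocountable_derivative_eq
    (cocountable_derivativeM df (cocountable_derivative_expR l)) => s _; ring.
have ge a b : 0 < a -> a <= b -> f b * expR (l * b) = f a * expR (l * a).
  move=> a0 ab; have d0 := cocountable_derivative_cst (0 : R).
  have := cocountable_derivative_le dg d0 a0 ab (fun _ _ => lexx _).
  have := cocountable_derivative_le d0 dg a0 ab (fun _ _ => lexx _).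
  lra.
have ft : f t * expR (l * t) = f 1 * expR (l * 1).
  by have [t1|/ltW t1] := leP t 1; [rewrite (ge t 1)|rewrite (ge 1 t)].
by rewrite mulNr -[in expR l](mulr1 l) -ft -mulrA -expRD subrr expR0 mulr1.
Qed.

(** [W] is [x^T G^-1 x + (2 c / l) expR (- l t)]. The inverse cancels the gain in the derivative,
    and the exponential contributes [- 2 c expR (- l t) <= - 2 |d|^2], which turns the excess
    [+ |d|^2] into [- |d|^2]. *)
Lemma gradient_flow_lyapunov (R : realType) (n k : nat) (G : 'M[R]_k)
    (x : R -> 'cV[R]_k) (E : R -> 'M[R]_(n, k)) (d : R -> 'cV[R]_n) (c l : R) :
  posdefmx G -> 0 < l -> 0 <= c ->
  (forall j, has_cocountable_derivative (fun t => x t j 0)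
     (fun t => (- (G *m (E t)^T *m (E t *m x t + d t))) j 0)) ->
  (forall t, 0 < t -> \sum_i d t i 0 ^+ 2 <= c * expR (- l * t)) ->
  exists W W' : R -> R, [/\ has_cocountable_derivative W W',
    (forall t, 0 < t -> 0 <= W t) &
    (forall t, 0 < t ->
       W' t <= - \sum_i ((E t *m x t) i 0 ^+ 2 + d t i 0 ^+ 2))].
Proof.
move=> Gpos l0 c0 dx dc; have Gu := posdefmx_unit Gpos; have [GT Gp] := Gpos.
pose P := invmx G; have PT : P^T = P by rewrite trmx_inv GT.
pose y t := - (G *m (E t)^T *m (E t *m x t + d t)).
have dV : has_cocountable_derivative
    (fun t => \sum_i \sum_j P i j * (x t i 0 * x t j 0))
    (fun t => \sum_i \sum_j P i j * (x t i 0 * y t j 0 + x t j 0 * y t i 0)).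
  do 2 apply: cocountable_derivative_sum => ?.
  exact/cocountable_derivativeZ/cocountable_derivativeM.
have dW := cocountable_derivativeD dV
  (cocountable_derivativeZ (2 * c / l) (cocountable_derivative_expR (- l))).
do 2 eexists; split; first exact: dW.
  move=> t _; apply: addr_ge0; last first.
    by rewrite mulr_ge0 ?expR_ge0// divr_ge0 ?(ltW l0)// mulr_ge0.
  (* Written with [P x], the form of the inverse is a form of [G], so positivity of [G] applies
     directly. *)
  have -> : \sum_i \sum_j P i j * (x t i 0 * x t j 0) =
      ((P *m x t)^T *m G *m (P *m x t)) 0 0.
    rewrite trmx_mul PT !mulmxA -[_ *m P *m G]mulmxA mulVmx// mulmx1.
    by rewrite mx_bilinearE; do 2 apply: eq_bigr => ? _; rewrite mulrC.
  have [->|Px0] := eqVneq (P *m x t) 0; first by rewrite mulmx0 mxE.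
  exact/ltW/Gp.
move=> t t0 /=.
have -> : \sum_i \sum_j P i j * (x t i 0 * y t j 0 + x t j 0 * y t i 0) =
    - (2 * \sum_i (E t *m x t) i 0 * ((E t *m x t) i 0 + d t i 0)).
  transitivity (2 * ((x t)^T *m P *m y t) 0 0).
    rewrite mulr_natl mulr2n.
    have {2}-> : ((x t)^T *m P *m y t) 0 0 = ((y t)^T *m P *m x t) 0 0.
      have tr11 (A : 'M[R]_1) : A 0 0 = A^T 0 0 by rewrite mxE.
      by rewrite tr11 !trmx_mul trmxK PT mulmxA.
    rewrite !mx_bilinearE -big_split /=; apply: eq_bigr => i _.
    rewrite -big_split /=; apply: eq_bigr => j _; ring.
  rewrite /y mulmxN !mulmxA -[_ *m P *m G]mulmxA mulVmx// mulmx1 -trmx_mul.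
  rewrite mxE mulrN mxE; congr (- (_ * _)); apply: eq_bigr => i _; rewrite mxE.
  by rewrite [in X in _ * X]mxE.
have -> : 2 * c / l * (- l * expR (- l * t)) = - (2 * (c * expR (- l * t))).
  by field; rewrite gt_eqF.
have := dc t t0; rewrite big_split /= => dct.
suff : - (2 * \sum_i (E t *m x t) i 0 * ((E t *m x t) i 0 + d t i 0)) <=
    - \sum_i (E t *m x t) i 0 ^+ 2 + \sum_i d t i 0 ^+ 2 by lra.
rewrite -mulrN -!sumrN mulr_sumr -big_split /=; apply: ler_sum => i _.
set e := (E t *m x t) i 0; set f := d t i 0.
(* Indeed [- 2 e (e + f) = - e^2 + f^2 - (e + f)^2]. *)
have := sqr_ge0 (e + f); lra.
Qed.

(** * Combinations of corners and entrywise bounds *)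

(** Choosing a corner index for each point and adding the coefficients with equal index leaves one
    weight per corner. *)
Lemma convex_hull_range_weights (R : realType) (V : lmodType R) (N : nat)
    (F : 'I_N -> V) (x : V) : convex_hull (range F) x ->
  exists2 w : 'I_N -> R, \sum_i w i = 1 & x = \sum_i w i *: F i.
Proof.
move=> [k [a [p [Fp _ a1 ->]]]].
have [f fE] : exists f : 'I_k -> 'I_N, forall i, F (f i) = p i.
  have /choice[f fE] : forall i, exists j, F j = p i.
    by move=> i; have [j _ <-] := Fp i; exists j.
  by exists f.
exists (fun j => \sum_(i | f i == j) a i).
  by rewrite -a1 (partition_big f xpredT).
rewrite (partition_big f xpredT)//=; apply: eq_bigr => j _.
by rewrite scaler_suml; apply: eq_bigr => i /eqP <-; rewrite fE.
Qed.

(** The constraint on the sum eliminates the last weight, as the scheme does with its last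
    estimate. *)
Lemma affine_combination_last (R : realType) (V : lmodType R) (K : nat)
    (w : 'I_(K + 1) -> R) (F : 'I_(K + 1) -> V) : \sum_i w i = 1 ->
  \sum_i w i *: F i =
  F (rshift K 0) +
  \sum_(l < K) w (lshift 1 l) *: (F (lshift 1 l) - F (rshift K 0)).
Proof.
rewrite !big_split_ord !big_ord1 /= => /(canRL (addKr _)) ->.
rewrite scalerDl scale1r scaleNr scaler_suml [LHS]addrC -addrA addrCA.
congr (_ + _); rewrite addrC -sumrB; apply: eq_bigr => l _.
by rewrite scalerBr.
Qed.

Lemma full_weights_sum (R : realType) (K : nat) (w : R -> 'cV[R]_K) t :
  \sum_i full_weights w t i 0 = 1.
Proof.
rewrite big_split_ord big_ord1 /= col_mxEd mxE.
by under eq_bigr do rewrite col_mxEu; rewrite addrC subrK.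
Qed.

Lemma normr_mulmx_le (R : realType) (m n p : nat) (A : 'M[R]_(m, n))
    (B : 'M[R]_(n, p)) (a b : R) i j :
  (forall i k, `|A i k| <= a) -> (forall k j, `|B k j| <= b) ->
  `|(A *m B) i j| <= n%:R * (a * b).
Proof.
move=> Aa Bb; rewrite mxE (le_trans (ler_norm_sum _ _ _))//.
rewrite mulr_natl -[n in _ *+ n]card_ord -sumr_const; apply: ler_sum => k _.
by rewrite normrM ler_pM.
Qed.

Lemma mx_entries_bounded (R : realType) (m n : nat) (A : 'M[R]_(m, n)) :
  exists2 a, 0 <= a & forall i j, `|A i j| <= a.
Proof.
exists (\sum_i \sum_j `|A i j|); first by do 2 apply: sumr_ge0 => ? _.
move=> i j; rewrite (bigD1 i)//= (bigD1 j)//= -addrA lerDl.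
by rewrite addr_ge0 ?sumr_ge0// => ? _; exact: sumr_ge0.
Qed.

Lemma entry_le_eucl_norm (R : realType) (k : nat) (v : 'cV[R]_k) i :
  `|v i 0| <= eucl_norm v.
Proof.
rewrite -sqrtr_sqr ler_sqrt; last by rewrite sumr_ge0// => ? _; exact: sqr_ge0.
by rewrite (bigD1 i)//= lerDl sumr_ge0// => ? _; exact: sqr_ge0.
Qed.

Lemma ms_sqr_ge1 (R : realType) (k : nat) (alpha : R) (Phi : R -> 'cV[R]_k) t :
  0 < alpha -> 1 <= ms_sqr alpha Phi t.
Proof. by move=> a0; rewrite lerDl mulr_ge0 ?sqr_ge0// ltW. Qed.

Lemma within_continuous_regressor (R : realType) (n m : nat) (A : set R)
    (phi1 : R -> 'cV[R]_n) (phi2 : R -> 'cV[R]_m) (i : 'I_(n + m)) :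
  {within A, continuous phi1} -> {within A, continuous phi2} ->
  {within A, continuous (fun t => regressor phi1 phi2 t i 0)}.
Proof.
move=> c1 c2; have [j ->|j ->] := split_ordP i.
  under eq_fun do rewrite col_mxEu.
  exact: within_continuous_coord.
under eq_fun do rewrite col_mxEd.
exact: within_continuous_coord.
Qed.

(** * Residual of the filtered system *)

(** Both [z'] and [Theta_p Phi'] contain [Ap xp + Bp u]; it cancels in the difference, so each
    coordinate of the residual solves [r' = - l r] whatever the input. *)
Lemma filtered_residual_decay (R : realType) (n m : nat)
    (Ap : 'M[R]_n) (Bp : 'M[R]_(n, m)) (l : R) (u phi2 : R -> 'cV[R]_m)
    (xp phi1 : R -> 'cV[R]_n) (x0 : 'cV[R]_n) :
  ivp_solution xp x0 (fun t => Ap *m xp t + Bp *m u t) ->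
  ivp_solution phi1 0 (fun t => - l *: phi1 t + xp t) ->
  ivp_solution phi2 0 (fun t => - l *: phi2 t + u t) ->
  exists c : 'cV[R]_n, forall t, 0 < t ->
    filtered_output l xp phi1 t - row_mx Ap Bp *m regressor phi1 phi2 t =
    expR (- l * t) *: c.
Proof.
move=> hx h1 h2.
pose r t := filtered_output l xp phi1 t - row_mx Ap Bp *m regressor phi1 phi2 t.
have dr i :
    has_cocountable_derivative (fun t => r t i 0) (fun t => - l * r t i 0).
  have dx := ivp_solution_coord i hx.
  have d1 j := ivp_solution_coord j h1.
  have d2 j := ivp_solution_coord j h2.
  have dA := cocountable_derivative_sum (index_enum 'I_n)
    (fun j => cocountable_derivativeZ (Ap i j) (d1 j)).
  have dB := cocountable_derivative_sum (index_enum 'I_m)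
    (fun j => cocountable_derivativeZ (Bp i j) (d2 j)).
  have := cocountable_derivativeD
    (cocountable_derivativeD (cocountable_derivativeZ (- l) (d1 i)) dx)
    (cocountable_derivativeZ (-1) (cocountable_derivativeD dA dB)).
  set f := (X in has_cocountable_derivative X _).
  have -> : f = (fun t => r t i 0).
    apply/funext => t; rewrite /f /r /filtered_output /regressor mul_row_col.
    by rewrite !mxE mulN1r.
  apply: cocountable_derivative_eq => t _.
  rewrite /r /filtered_output /regressor mul_row_col.
  have -> : \sum_j Ap i j * (- l *: phi1 t + xp t) j 0 =
      (Ap *m (- l *: phi1 t + xp t)) i 0 by rewrite [RHS]mxE.
  have -> : \sum_j Bp i j * (- l *: phi2 t + u t) j 0 =
      (Bp *m (- l *: phi2 t + u t)) i 0 by rewrite [RHS]mxE.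
  rewrite !mulmxDr -!scalemxAr !(mxE, mulrDr).
  move: (\sum_j _) (\sum_j _) (\sum_j _) (\sum_j _) => *; ring.
have /choice[c cE] : forall i, exists c,
    forall t, 0 < t -> r t i 0 = c * expR (- l * t).
  by move=> i; exact: decay_ode.
exists (\col_i c i) => t t0; apply/colP => i.
by rewrite -/(r t) cE// !mxE mulrC.
Qed.

(** * Convergence of the estimated system matrix *)

Theorem theorem2 (R : realType) (n m K : nat)
    (Ap : 'M[R]_n) (Bp : 'M[R]_(n, m)) (hBp : full_column_rank Bp)
    (u : R -> 'cV[R]_m) (xp : R -> 'cV[R]_n) (xp0 : 'cV[R]_n)
    (hxp : ivp_solution xp xp0 (fun t => Ap *m xp t + Bp *m u t))
    (A : 'I_(K + 1) -> 'M[R]_n) (B : 'I_(K + 1) -> 'M[R]_(n, m))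
    (hS : admissible_corner_set Ap Bp A B)
    (lambda alpha : R) (hlambda : 0 < lambda) (halpha : 0 < alpha)
    (phi1 : R -> 'cV[R]_n) (phi2 : R -> 'cV[R]_m)
    (hphi1 : ivp_solution phi1 0 (fun t => - lambda *: phi1 t + xp t))
    (hphi2 : ivp_solution phi2 0 (fun t => - lambda *: phi2 t + u t))
    (Gamma : 'M[R]_K) (hGamma : posdefmx Gamma) :
  let Theta := fun i => row_mx (A i) (B i) in
  let Phi := regressor phi1 phi2 in
  let z := filtered_output lambda xp phi1 in
  let eps := fun i => estimation_error alpha z Phi (Theta i) in
  let E := error_diff_mx eps in
  bounded_signal Phi -> persistently_exciting Phi ->
  forall (wbar0 : 'cV[R]_K) (wbar : R -> 'cV[R]_K),
  ivp_solution wbar wbar0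
    (fun t => - (Gamma *m (E t)^T *m E t *m wbar t)
              - Gamma *m (E t)^T *m eps (rshift K 0) t) ->
  (fun t => \sum_(i < K + 1) full_weights wbar t i 0 *: Theta i) t @[t --> +oo]
    --> row_mx Ap Bp.
Proof.
move=> Theta Phi z eps E [M0 PhiM0] [a [a2 [T [a0 _ T0 PE]]]] wbar0 wbar hw.
have [om om1 omE] := convex_hull_range_weights hS.1.1.
pose N := rshift K (0 : 'I_1).
pose D (l : 'I_K) : 'M[R]_(n, n + m) := Theta (lshift 1 l) - Theta N.
(* The linear map from free weights to matrices: [comb (x t)] is the error of the estimate, and the
   only quantity shown to vanish. *)
pose comb (v : 'cV[R]_K) : 'M[R]_(n, n + m) := \sum_l v l 0 *: D l.
pose x t : 'cV[R]_K := wbar t - \col_l om (lshift 1 l).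
have combB v w : comb (v - w) = comb v - comb w.
  by rewrite -sumrB; apply: eq_bigr => l _; rewrite !mxE scalerBl.
have ThetaE : row_mx Ap Bp = Theta N + comb (\col_l om (lshift 1 l)).
  rewrite omE (affine_combination_last _ om1); congr (_ + _).
  by apply: eq_bigr => l _; rewrite mxE.
have estE t : \sum_i full_weights wbar t i 0 *: Theta i =
    row_mx Ap Bp + comb (x t).
  rewrite (affine_combination_last _ (full_weights_sum wbar t)) combB ThetaE.
  rewrite -[RHS]addrA [X in _ = _ + X]addrC subrK; congr (_ + _).
  by apply: eq_bigr => l _; rewrite col_mxEu.
pose s t := (ms_sqr alpha Phi t)^-1.
have ms1 t : 1 <= ms_sqr alpha Phi t by exact: ms_sqr_ge1.
have ms0 t : 0 < ms_sqr alpha Phi t by exact: lt_le_trans (ms1 t).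
have s0 t : 0 <= s t by rewrite invr_ge0 ltW.
have s1 t : s t <= 1 by rewrite invf_le1.
pose d t := s t *: (z t - row_mx Ap Bp *m Phi t).
(* The signal [z] cancels in the differences of errors, which leaves a multiple of
   [D l *m Phi t]. *)
have EcolE t i l : E t i l = - s t * (D l *m Phi t) i 0.
  rewrite mxE /eps /estimation_error -/(s t) -scalerBr mxE mulNr -mulrN.
  congr (_ * _); rewrite mulmxBl.
  by move: (_ *m _) (_ *m _) => ? ?; rewrite !mxE; ring.
have EvE t v : E t *m v = - s t *: (comb v *m Phi t).
  apply/colP => i; rewrite mxE [RHS]mxE mulmx_suml summxE mulr_sumr.
  by apply: eq_bigr => l _; rewrite EcolE -scalemxAl [in RHS]mxE; ring.
(* As [d] equals [eps N] plus [E] applied to the true weights, the scheme becomes an equation for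
   [x] perturbed by [d]. *)
have errE t : E t *m x t + d t = E t *m wbar t + eps N t.
  rewrite !EvE combB mulmxBl scalerBr -addrA; congr (_ + _).
  rewrite /d /eps /estimation_error -/(s t) ThetaE mulmxDl opprD addrA.
  by rewrite !scalerBr scaleNr opprK addrC subrK.
pose y t := - (Gamma *m (E t)^T *m (E t *m x t + d t)).
have dx l : has_cocountable_derivative (fun t => x t l 0) (fun t => y t l 0).
  have := cocountable_derivativeD (ivp_solution_coord l hw)
    (cocountable_derivative_cst (- om (lshift 1 l))).
  have -> : (fun t => wbar t l 0 + - om (lshift 1 l)) = (fun t => x t l 0).
    by apply/funext => t; rewrite !mxE.
  apply: cocountable_derivative_eq => t _; rewrite addr0 /y errE mulmxDr opprD.
  by rewrite -mulmxA.
have [c cE] := filtered_residual_decay hxp hphi1 hphi2.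
have dc t : 0 < t -> \sum_i d t i 0 ^+ 2 <=
    (\sum_i c i 0 ^+ 2) * expR (- (2 * lambda) * t).
  move=> t0; rewrite mulr_suml; apply: ler_sum => i _; rewrite /d cE// !mxE.
  have -> : expR (- (2 * lambda) * t) = expR (- lambda * t) ^+ 2.
    by rewrite expr2 -expRD; congr expR; ring.
  move: (expR _) (c i 0) => e b.
  have -> : (s t * (e * b)) ^+ 2 = s t ^+ 2 * (b ^+ 2 * e ^+ 2) by ring.
  rewrite ler_piMl//; first by apply: mulr_ge0; exact: sqr_ge0.
  by rewrite -(expr1n _ 2) ler_sqr ?nnegrE.
have l20 : 0 < 2 * lambda by rewrite mulr_gt0.
have c0 : 0 <= \sum_i c i 0 ^+ 2 by rewrite sumr_ge0// => i _; exact: sqr_ge0.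
have [W [W' [dW W0 W'q]]] := gradient_flow_lyapunov hGamma l20 c0 dx dc.
set q := fun t => \sum_i ((E t *m x t) i 0 ^+ 2 + d t i 0 ^+ 2).
have q0 t : 0 < t -> 0 <= q t.
  by move=> _; rewrite sumr_ge0// => i _; rewrite addr_ge0 ?sqr_ge0.
have PhiM t i : 0 < t -> `|Phi t i 0| <= M0.
  by move=> /ltW /PhiM0; apply: le_trans; exact: entry_le_eucl_norm.
have cPhi i : {within `[0, +oo[, continuous (fun t => Phi t i 0)}.
  by apply: within_continuous_regressor; [case: hphi1|case: hphi2].
(* The gain is bounded since [Phi] is bounded and the normalisation [s] lies in [0, 1]. The outer
   absolute value in the witness makes its sign immediate. *)
have [g g0 gE] : exists2 g, 0 <= g & forall t i j, 0 < t ->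
    `|(Gamma *m (E t)^T) i j| <= g.
  have [G _ GE] := mx_entries_bounded Gamma.
  have [B0 _ BE] := mx_entries_bounded (\matrix_(i, j) \sum_l `|D l i j|).
  exists `|K%:R * (G * ((n + m)%:R * (B0 * M0)))| => // t i j t0.
  rewrite (le_trans _ (ler_norm _))//; apply: normr_mulmx_le => // l {}j.
  rewrite mxE EcolE normrM normrN (ger0_norm (s0 t)).
  rewrite (le_trans (ler_piMl _ (s1 t)))//; apply: normr_mulmx_le => [p r|r p].
    have := BE p r; rewrite mxE; apply: le_trans.
    rewrite (le_trans _ (ler_norm _))// (bigD1 l)//= lerDl.
    by rewrite sumr_ge0.
  by rewrite ord1; exact: PhiM.
have yC l e t : 0 < e -> 0 < t ->
    `|y t l 0| <= g * (2 * n%:R + 1) * (e + q t / e).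
  move=> e0 t0; rewrite mxE normrN mxE (le_trans (ler_norm_sum _ _ _))//.
  apply: (@le_trans _ _ (\sum_(i < n)
      g * (2 * e + ((E t *m x t) i 0 ^+ 2 + d t i 0 ^+ 2) / e))).
    apply: ler_sum => i _; rewrite normrM ler_pM// ?gE// mxE.
    rewrite (le_trans (ler_normD _ _))// mulrDl.
    (* Young's inequality trades the square root of [q] for [e + q / e], the form expected by the
       slow variation argument. *)
    have young b : `|b| <= e + b ^+ 2 / e.
      rewrite -(ler_pM2r e0) mulrDl divfK ?gt_eqF// -(real_normK (num_real b)).
      have := sqr_ge0 (`|b| - e); have := mulr_ge0 (normr_ge0 b) (ltW e0); nra.
    have := young ((E t *m x t) i 0); have := young (d t i 0); lra.
  rewrite -mulr_sumr -mulrA ler_wpM2l// big_split /=.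
  rewrite -[X in _ + X <= _]mulr_suml -/(q t) sumr_const card_ord
    -[_ *+ n]mulr_natl.
  have r0 : 0 <= q t / e by rewrite divr_ge0 ?q0 ?ltW.
  have := mulr_ge0 (ler0n R n) r0; lra.
rewrite (_ : (fun t => _) = fun t => row_mx Ap Bp + comb (x t)); last first.
  by apply/funext => t; exact: estE.
apply: cvg_mx => i j.
(* The matrix error is treated one row at a time, each row being a vector tested against [Phi]. *)
pose v t : 'cV[R]_(n + m) := (row i (comb (x t)))^T.
pose v' t : 'cV[R]_(n + m) := (row i (comb (y t)))^T.
have combE w k : (row i (comb w))^T k 0 = \sum_l D l i k * w l 0.
  by rewrite !mxE summxE; apply: eq_bigr => l _; rewrite mxE mulrC.
have dv k : has_cocountable_derivative (fun t => v t k 0) (fun t => v' t k 0).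
  rewrite /v /v'; under eq_fun do rewrite combE.
  under [X in has_cocountable_derivative _ X]eq_fun do rewrite combE.
  by apply: cocountable_derivative_sum => l; exact: cocountable_derivativeZ.
have [b b0 bE] := mx_entries_bounded (\matrix_(l, k) D l i k).
have C0 : 0 <= K%:R * b * (g * (2 * n%:R + 1)).
  by rewrite !mulr_ge0// addr_ge0// mulr_ge0.
have v'C k e t : 0 < e -> 0 < t ->
    `|v' t k 0| <= K%:R * b * (g * (2 * n%:R + 1)) * (e + q t / e).
  move=> e0 t0; rewrite combE (le_trans (ler_norm_sum _ _ _))//.
  rewrite -2!mulrA mulr_natl -[K in _ *+ K]card_ord -sumr_const.
  apply: ler_sum => l _; rewrite normrM ler_pM//; last exact: yC.
  by have := bE l k; rewrite mxE.
have vPhi t : 0 < t ->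
    (\sum_k v t k 0 * Phi t k 0) ^+ 2 <= (1 + alpha * M0 ^+ 2) ^+ 2 * q t.
  move=> t0.
  (* Undoing the normalisation expresses the product through [E x], whose squared entries are part
     of [q]; boundedness of [Phi] controls the factor [ms_sqr]. *)
  have -> : \sum_k v t k 0 * Phi t k 0 =
      - ms_sqr alpha Phi t * (E t *m x t) i 0.
    rewrite EvE [in RHS]mxE mulrA mulrNN mulfV ?gt_eqF// mul1r mxE.
    by apply: eq_bigr => k _; rewrite !mxE.
  rewrite mulNr sqrrN exprMn ler_pM ?sqr_ge0//.
    rewrite ler_sqr ?nnegrE ?(ltW (ms0 t))//; last first.
      by rewrite addr_ge0// mulr_ge0 ?sqr_ge0// ltW.
    rewrite lerD2l ler_wpM2l ?(ltW halpha)// ler_sqr ?nnegrE ?sqrtr_ge0//.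
      exact/PhiM0/ltW.
    by apply: le_trans (PhiM0 t (ltW t0)); exact: sqrtr_ge0.
  rewrite /q (bigD1 i)//= -addrA lerDl addr_ge0 ?sqr_ge0// sumr_ge0// => k _.
  by rewrite addr_ge0 ?sqr_ge0.
have vj := excited_vanish dW W0 q0 W'q cPhi PhiM a0 T0
  (fun t t0 => (PE t (ltW t0)).1) C0 (sqr_ge0 _) dv v'C vPhi j.
rewrite (_ : (fun t => _) = fun t => row_mx Ap Bp i j + v t j 0); last first.
  by apply/funext => t; rewrite /v [LHS]mxE; congr (_ + _); rewrite !mxE.
rewrite -[X in _ --> X]addr0.
by apply: cvgD => //; exact: cvg_cst.
Qed.
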